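(* $\mathrm{A}_\ell\text{-FP-sel}\subsetneq \mathrm{P}/n+1$. That is, every set having an FP-selector function that is associative at each length belongs to $\mathrm{P}/n+1$, and some set in $\mathrm{P}/n+1$ has no FP-selector function that is associative at each length.
   Context: $\Sigma=\{0,1\}$. FP is the class of (possibly partial) single-valued functions computable in deterministic polynomial time; here functions are 2-ary, from $\Sigma^*\times\Sigma^*$ to $\Sigma^*$. For such $f$ put $\text{set-}f(x,y)=\{f(x,y)\}$ if $f(x,y)$ is defined and $\emptyset$ otherwise; for sets $A$, $\text{set-}f(A,y)=\bigcup_{a\in A}\text{set-}f(a,y)$ and $\text{set-}f(y,A)=\bigcup_{a\in A}\text{set-}f(y,a)$. An FP-selector function for $B\subseteq\Sigma^*$ is a function $f\in\mathrm{FP}$ such that for all $x,y$: $\text{set-}f(x,y)\subseteq\{x,y\}$, and if $\{x,y\}\cap B\neq\emptyset$ then $\text{set-}f(x,y)\neq\emptyset$ and $\text{set-}f(x,y)\subseteq B$. $f$ is associative at each length if for every $n$ and all $a,b,c\in\Sigma^n$, $\text{set-}f(a,\text{set-}f(b,c))=\text{set-}f(\text{set-}f(a,b),c)$. $\mathrm{A}_\ell$-FP-sel is the class of sets having an FP-selector function that is associative at each length. A set $B$ is in $\mathrm{P}/n+1$ if there are a set $C\in\mathrm{P}$ and a function $h:1^*\to\Sigma^*$ (not necessarily computable) such that for all $x\in\Sigma^*$: $|h(1^{|x|})|=|x|+1$ and $x\in B\iff\langle x,h(1^{|x|})\rangle\in C$, where $\langle\cdot,\cdot\rangle$ is a standard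 polynomial-time computable and invertible pairing function. *)

(* Defs.v *)
From mathcomp Require Import all_boot all_order all_algebra.
From mathcomp Require Import classical_sets.

Set Implicit Arguments.
Unset Strict Implicit.
Unset Printing Implicit Defensive.

Local Open Scope classical_set_scope.

Definition word := seq bool.

(** * Deterministic multi-tape Turing machines *)

(* Tape alphabet: the blank [None], the two input symbols, and [m] auxiliary
   work symbols. *)
Definition symbol (m : nat) : finType := option (bool + 'I_m).

Definition bit (m : nat) (b : bool) : symbol m := Some (inl b).

(* A two-way infinite tape, blank almost everywhere.  [(l, r)] lists in [r] the
   cells from the scanned one rightwards, and in [l] the cells to the left of
   the head, nearest first; all further cells are blank. *)
Definition tape (m : nat) := (seq (symbol m) * seq (symbol m))%type.

Inductive direction := MoveLeft | MoveNone | MoveRight.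

Definition tape_read (m : nat) (t : tape m) : symbol m := head None t.2.

Definition tape_write (m : nat) (a : symbol m) (t : tape m) : tape m :=
  (t.1, a :: behead t.2).

Definition tape_move (m : nat) (d : direction) (t : tape m) : tape m :=
  match d with
  | MoveLeft => (behead t.1, head None t.1 :: t.2)
  | MoveNone => t
  | MoveRight => (tape_read t :: t.1, behead t.2)
  end.

Definition tape_of_word (m : nat) (x : word) : tape m :=
  ([::], [seq bit m b | b <- x]).

Fixpoint leading_bits (m : nat) (s : seq (symbol m)) : word :=
  if s is Some (inl b) :: s' then b :: leading_bits s' else [::].

(* The output written on a tape: the bits from the scanned cell rightwards, up
   to the first cell that does not hold a bit. *)
Definition word_of_tape (m : nat) (t : tape m) : word := leading_bits t.2.

(* A machine with [r] input tapes, [tm_work] work tapes and one output tape.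
   Its control is either in a working state [inl q], or has halted by
   accepting ([inr true]) or rejecting ([inr false]). *)
Record TM (r : nat) := MkTM {
  tm_work : nat;
  tm_aux : nat;
  tm_nstates : nat;
  tm_start : 'I_tm_nstates;
  tm_delta : 'I_tm_nstates -> {ffun 'I_(r + tm_work).+1 -> symbol tm_aux} ->
    ('I_tm_nstates + bool) *
    {ffun 'I_(r + tm_work).+1 -> symbol tm_aux * direction}
}.

Record config (r : nat) (M : TM r) := MkConfig {
  cfg_state : 'I_(tm_nstates M) + bool;
  cfg_tapes : {ffun 'I_(r + tm_work M).+1 -> tape (tm_aux M)}
}.

(* Tapes of index at least [r] start blank, by the default value of [nth]. *)
Definition tm_init (r : nat) (M : TM r) (xs : r.-tuple word) : config M :=
  MkConfig (inl (tm_start M))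
    [ffun i : 'I_(r + tm_work M).+1 => tape_of_word (tm_aux M) (nth [::] xs i)].

Definition tm_step (r : nat) (M : TM r) (c : config M) : config M :=
  match cfg_state c with
  | inr _ => c
  | inl q =>
    let: (q', act) := tm_delta q [ffun i => tape_read (cfg_tapes c i)] in
    MkConfig q'
      [ffun i => tape_move (act i).2 (tape_write (act i).1 (cfg_tapes c i))]
  end.

Definition tm_run (r : nat) (M : TM r) (xs : r.-tuple word) (t : nat)
  : config M := iter t (@tm_step r M) (tm_init M xs).

Definition tm_output (r : nat) (M : TM r) (c : config M) : word :=
  word_of_tape (cfg_tapes c ord_max).

Definition accepts_within (r : nat) (M : TM r) (xs : r.-tuple word) (t : nat) :=
  cfg_state (tm_run M xs t) = inr true.

Definition rejects_within (r : nat) (M : TM r) (xs : r.-tuple word) (t : nat) :=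
  cfg_state (tm_run M xs t) = inr false.

(** * Polynomial time *)

Definition class_P : set (set word) := [set C |
  exists (M : TM 1) (p : {poly nat}), forall x : word,
    let t := p.[size x]%R in
    (C x -> accepts_within M [tuple x] t) /\
    (~ C x -> rejects_within M [tuple x] t)].

(* Partial functions are [option]-valued; the machine always halts in
   polynomial time, and rejects exactly where the function is undefined. *)
Definition class_FP : set (word -> word -> option word) := [set f |
  exists (M : TM 2) (p : {poly nat}), forall x y : word,
    let t := p.[(size x + size y)%N]%R in
    match f x y with
    | Some z => accepts_within M [tuple x; y] t /\
                tm_output (tm_run M [tuple x; y] t) = z
    | None => rejects_within M [tuple x; y] t
    end].

(** * Selector functions *)

Definition set_f (f : word -> word -> option word) (x y : word) : set word :=
  [set z | f x y = Some z].

Definition set_f_l (f : word -> word -> option word) (A : set word) (y : word)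
  : set word := \bigcup_(a in A) set_f f a y.

Definition set_f_r (f : word -> word -> option word) (y : word) (A : set word)
  : set word := \bigcup_(a in A) set_f f y a.

Definition FP_selector (B : set word) (f : word -> word -> option word) :=
  class_FP f /\
  forall x y : word,
    set_f f x y `<=` [set x; y] /\
    ([set x; y] `&` B !=set0 -> set_f f x y !=set0 /\ set_f f x y `<=` B).

Definition associative_at_each_length (f : word -> word -> option word) :=
  forall (n : nat) (a b c : n.-tuple bool),
    set_f_r f a (set_f f b c) = set_f_l f (set_f f a b) c.

Definition Al_FP_sel : set (set word) := [set B |
  exists f, FP_selector B f /\ associative_at_each_length f].

(** * Advice *)

(* [x] with every bit doubled, then the separator 01, then [y]. *)
Definition pairing (x y : word) : word :=
  flatten [seq [:: b; b] | b <- x] ++ [:: false; true] ++ y.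

(* The domain 1^* of the advice function is identified with [nat]. *)
Definition P_slash_n_plus_1 : set (set word) := [set B |
  exists (C : set word) (h : nat -> word), class_P C /\
    forall x : word,
      size (h (size x)) = (size x + 1)%N /\
      (B x <-> C (pairing x (h (size x))))].

(* Main.v *)
(** On the words of B of length n, an associative selector is an associative
    operation g with g x y in {x, y}, and "y strictly beats x", that is
    g x y = g y x = y <> x, is a strict partial order.  Let w be minimal, so
    that w beats nothing.  If g x w <> x for some x, then x is minimal too and
    both w and x are left identities: g w y = y and g x y = y for all y.  Hence
    for some w in B and some side d, a word y is in B iff the selector, applied
    to y and w in the order d, returns y (if y is outside B, it must return w).
    The pair (w, d) takes n+1 bits.  When w has to go on the left there is a
    choice between w and x, so the pair (0^n, left) is never needed and can
    encode that B is empty at length n.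

    For strictness, a set in which membership depends only on the length can be
    chosen to defeat the k-th Turing machine on a pair of words of lengths 2k
    and 2k+1, by accepting exactly the length that the machine does not
    select. *)

Require Import Defs.
From HB Require Import structures.
From mathcomp Require Import all_boot all_order all_algebra.
From mathcomp Require Import boolp classical_sets zify.

Set Implicit Arguments.
Unset Strict Implicit.
Unset Printing Implicit Defensive.

(** * Finite quasitrivial semigroups *)

Lemma minimal_of_transitive_irreflexive (T : finType) (P : pred T) (r : rel T)
    (x0 : T) :
    P x0 -> (forall x, ~~ r x x) ->
    (forall x y z, P x -> P y -> P z -> r x y -> r y z -> r x z) ->
  exists2 w, P w & forall x, P x -> ~~ r x w.
Proof.
move=> Px0 irr tr; pose below x := [set y | P y && r y x].
(* Choose [w] with the fewest predecessors; a predecessor of [w] would have strictly fewer. *)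
case: (@arg_minnP T x0 P (fun x => #|below x|) Px0) => w Pw minw.
exists w => // x Px; apply/negP => rxw.
have /proper_card : below x \proper below w.
  apply/properP; split; last by exists x; rewrite !inE Px // (negbTE (irr x)).
  apply/fintype.subsetP => y; rewrite !inE => /andP[Py ryx].
  by rewrite Py (tr y x w).
by rewrite ltnNge minw.
Qed.

Section QuasitrivialBand.
Variables (T : finType) (P : pred T) (g : T -> T -> T).
Hypothesis sel : forall x y, P x -> P y -> g x y = x \/ g x y = y.
Hypothesis assoc :
  forall x y z, P x -> P y -> P z -> g x (g y z) = g (g x y) z.

Lemma quasitrivial_base (x0 : T) :
    P x0 ->
  exists2 w, P w & forall x, P x -> g x w = x \/ g w x = x.
Proof.
move=> Px0.
pose r x y := [&& x != y, g x y == y & g y x == y].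
have [||w Pw minw] := @minimal_of_transitive_irreflexive T P r x0 Px0.
- by move=> x; rewrite /r eqxx.
- move=> x y z Px Py Pz /and3P[nxy /eqP xy /eqP yx] /and3P[nyz /eqP yz /eqP zy].
  have xz : g x z = z by rewrite -yz assoc // xy.
  have zx : g z x = z by rewrite -{1}zy -assoc // yx.
  apply/and3P; split; rewrite ?xz ?zx //; apply/eqP => exz.
  by case/eqP: nxy; rewrite exz -yz -exz.
exists w => // x Px; have := minw x Px; rewrite /r !negb_and negbK.
case/or3P => [/eqP<-|nxw|nwx].
- by left; case: (sel Px Px).
- by left; case: (sel Px Pw) => // e; rewrite e eqxx in nxw.
- by right; case: (sel Pw Px) => // e; rewrite e eqxx in nwx.
Qed.

(** Here [z] is barred from the left side, later as 0^n; failure on the right yields two left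
    identities to choose from. *)
Lemma quasitrivial_one_sided_base (x0 z : T) :
    P x0 ->
  exists w (d : bool), [/\ P w, ~~ (d && (w == z)) &
    forall x, P x -> (if d then g w x else g x w) = x].
Proof.
move=> /quasitrivial_base[w Pw basew].
have [L|/existsNP[y /not_implyP[Py nyw]]] :=
  pselect (forall x, P x -> g x w = x).
  by exists w, false; split.
have yw : g y w = w by case: (sel Py Pw).
have wy : g w y = y by case: (basew y Py).
have R x : P x -> g w x = x.
  move=> Px; case: (sel Pw Px) => // wx.
  case: (basew x Px) => // xw.
  (* If [g x y = x] then [y = g w y = g w (g x y) = w], against [nyw]; if [g x y = y] then
     [w = g y w = g x (g y w) = x]. *)
  have [xy|xy] := sel Px Py.
    by case: nyw; rewrite yw -wy -{2}wx -assoc // xy wx.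
  by rewrite wx -xw -{2}yw assoc // xy.
have Ry x : P x -> g y x = x by move=> Px; rewrite -{1}(R x Px) assoc // yw R.
have [wz|nwz] := eqVneq w z; last by exists w, true; split; rewrite // (negbTE nwz).
exists y, true; split=> //; apply/eqP => yz.
by apply: nyw; rewrite yw yz wz.
Qed.
End QuasitrivialBand.

Local Open Scope classical_set_scope.

(** * Halted runs and monotone time bounds *)

Lemma iter_tm_step_halted (r : nat) (M : TM r) (c : config M) (b : bool) n :
  cfg_state c = inr b -> iter n (@tm_step r M) c = c.
Proof. by move=> cb; elim: n => //= n ->; rewrite /tm_step cb. Qed.

Lemma tm_run_halted (r : nat) (M : TM r) (xs : r.-tuple word) b t t' :
  cfg_state (tm_run M xs t) = inr b -> t <= t' ->
  tm_run M xs t' = tm_run M xs t.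
Proof.
move=> h /subnK <-; rewrite /tm_run iterD; exact: iter_tm_step_halted h.
Qed.

Lemma horner_nat_leq (p : {poly nat}) (m n : nat) :
  m <= n -> p.[m]%R <= p.[n]%R.
Proof.
move=> mn; elim/poly_ind: p => [|p c IHp]; first by rewrite !horner0.
by rewrite !hornerMXaddC; apply: leq_add => //; apply: leq_mul.
Qed.

(** * Strictness by diagonalization over all machines *)

Definition option_of_direction (d : direction) : option bool :=
  match d with MoveLeft => Some false | MoveNone => None | MoveRight => Some true end.

Definition direction_of_option (o : option bool) : direction :=
  match o with Some false => MoveLeft | None => MoveNone | Some true => MoveRight end.

Lemma option_of_directionK : cancel option_of_direction direction_of_option.
Proof. by case. Qed.

HB.instance Definition _ := Countable.copy direction (can_type option_of_directionK).

Lemma TM_enumerable (r : nat) :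
  exists E : nat -> option (TM r), forall M, exists k, E k = Some M.
Proof.
pose table w a n := ('I_n * {ffun 'I_n * {ffun 'I_(r + w).+1 -> symbol a} ->
  ('I_n + bool) * {ffun 'I_(r + w).+1 -> symbol a * direction}})%type.
pose code := {w : nat & {a : nat & {n : nat & table w a n}}}.
pose decode (c : code) := let: existT w (existT a (existT n (q, d))) := c in
  MkTM q (fun q s => d (q, s)).
exists (fun k => omap decode (unpickle k)) => -[w a n q d].
pose c : code := existT _ w (existT _ a (existT _ n (q, [ffun qs => d qs.1 qs.2]))).
exists (pickle c); rewrite pickleK /=; congr (Some (MkTM _ _)).
by apply: funext => q'; apply: funext => s; rewrite ffunE.
Qed.

Definition computes_within (M : TM 2) (p : {poly nat})
    (f : word -> word -> option word) := forall x y : word,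
    let t := p.[(size x + size y)%N]%R in
    match f x y with
    | Some z => accepts_within M [tuple x; y] t /\
                tm_output (tm_run M [tuple x; y] t) = z
    | None => rejects_within M [tuple x; y] t
    end.

(** The right-hand side mentions no clock, so the diagonal argument enumerates machines only. Halted
    configurations do not change, hence all halting times agree. *)
Lemma computes_withinP (M : TM 2) p f x y z :
  computes_within M p f ->
  f x y = Some z <->
  exists t, accepts_within M [tuple x; y] t /\
            tm_output (tm_run M [tuple x; y] t) = z.
Proof.
move=> Mf; split=> [fxy|[t [acc out]]].
  by move: (Mf x y); rewrite fxy; exists p.[(size x + size y)%N]%R.
move: (Mf x y) => /=; set t' := p.[_]%R.
have e b : cfg_state (tm_run M [tuple x; y] t') = inr b ->
    tm_run M [tuple x; y] t' = tm_run M [tuple x; y] t.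
  case: (leqP t t') => [tt' _|/ltnW t't h].
    exact: tm_run_halted acc tt'.
  by rewrite (tm_run_halted h t't).
case: (f x y) => [z' [acc' <-]|rej]; first by rewrite (e _ acc') out.
by move: acc; rewrite /accepts_within -(e _ rej) rej.
Qed.

(* The state is the last bit read, [false] initially. *)
Section LastBit.

Let delta (q : 'I_2) (s : {ffun 'I_(1 + 0).+1 -> symbol 0}) :
    ('I_2 + bool) * {ffun 'I_(1 + 0).+1 -> symbol 0 * direction} :=
  (if s ord0 is Some (inl b) then inl (inord b) else inr (q == 1 :> nat),
   [ffun i => (s i, MoveRight)]).

Let M : TM 1 := @MkTM 1 0 0 2 ord0 delta.

Lemma class_P_last : class_P [set z | last false z].
Proof.
(* Generalized over the unread input and the last bit seen; the extra step reads the blank after the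
   input. *)
suff run (z : word) (b : bool) (c : config M) :
    cfg_state c = inl (inord b) -> (cfg_tapes c ord0).2 = map (bit 0) z ->
    cfg_state (iter (size z).+1 (@tm_step 1 M) c) = inr (last b z).
  exists M, ('X + 1)%R => z /=; rewrite !hornerE /=.
  have := @run z false (tm_init M [tuple z]).
  rewrite -[(size z).+1]addn1 /accepts_within /rejects_within /tm_run => ->.
  - by split=> [->|/negP/negbTE->].
  - by congr inl; apply/val_inj; rewrite /= inordK.
  - by rewrite /= ffunE.
elim: z b c => [|a z IHz] b c cb cz.
  by rewrite /= /tm_step cb /= !ffunE /tape_read cz /= inordK; case: b {cb}.
rewrite iterSr; apply: IHz; rewrite /tm_step cb /= !ffunE /tape_read cz //=.
by rewrite cz.
Qed.
End LastBit.

Lemma last_pairing x y : y != [::] -> last false (pairing x y) = last false y.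
Proof. by rewrite /pairing !last_cat /=; case: y. Qed.

(** The advice repeats the bit [c n] to fill n+1 places; the last bit of the pair then decides. *)
Lemma length_class_advice (c : nat -> bool) :
  P_slash_n_plus_1 [set x | c (size x)].
Proof.
exists [set z | last false z], (fun n => nseq n.+1 (c n)).
split; first exact: class_P_last.
move=> x; rewrite size_nseq addn1; split=> //=.
by rewrite last_pairing //=; elim: (size x) (c _) => //=.
Qed.

Lemma length_class_without_selector :
  exists c : nat -> bool, forall f, ~ FP_selector [set x | c (size x)] f.
Proof.
have [E surjE] := TM_enumerable 2.
pose u k : word := nseq k.*2 false; pose v k : word := nseq k.*2.+1 false.
pose D k := if E k is Some M then
  `[< exists t, accepts_within M [tuple u k; v k] t /\
                tm_output (tm_run M [tuple u k; v k] t) = u k >] else false.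
(* Exactly one of the lengths 2k and 2k+1 is accepted: the odd one if machine k selects [u k], the
   even one otherwise. *)
pose c n := if odd n then D n./2 else ~~ D n./2.
exists c => f [[M [p Mf]] fsel].
have [k Ek] := surjE M.
have cu : c (size (u k)) = ~~ D k by rewrite /c size_nseq odd_double doubleK.
have cv : c (size (v k)) = D k.
  by rewrite /c size_nseq /= odd_double /= uphalf_double.
have DP : D k <-> f (u k) (v k) = Some (u k).
  by rewrite /D Ek (computes_withinP _ _ _ Mf); split=> /asboolP.
have [sub tot] := fsel (u k) (v k).
have [|[z fz] subB] := (tot _).
  case: (boolP (D k)) => Dk; [exists (v k)|exists (u k)]; split; rewrite /= ?cu ?cv //.
    by right.
  by left.
have := subB z fz => /=.
case: (sub _ fz) => /= e; move: fz; rewrite /set_f /= e ?cu ?cv => fz.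
  by move/DP: fz => -> /=.
(* If [v k] is selected and in the set, [D k] holds, so the output is also [u k], of another
   length. *)
by move/DP; rewrite fz => -[/(congr1 size)]; rewrite /u /v /= !size_nseq; lia.
Qed.

(** * Tapes up to blanks *)

(* A tape up to trailing blanks, as the contents of the cells left of the head
   and from the head rightwards; unlike [tape], writing back the symbol just
   read leaves it unchanged. *)
Definition stape (m : nat) := ((nat -> symbol m) * (nat -> symbol m))%type.

Definition sem (m : nat) (t : tape m) : stape m := (nth None t.1, nth None t.2).

Definition sread (m : nat) (t : stape m) : symbol m := t.2 0.

Definition scons (m : nat) (a : symbol m) (u : nat -> symbol m) :=
  fun i => if i is j.+1 then u j else a.

Definition sact (m : nat) (ad : symbol m * direction) (t : stape m) : stape m :=
  let tl := fun i => t.2 i.+1 in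
  match ad.2 with
  | MoveLeft => (fun i => t.1 i.+1, scons (t.1 0) (scons ad.1 tl))
  | MoveNone => (t.1, scons ad.1 tl)
  | MoveRight => (scons ad.1 t.1, tl)
  end.

Lemma sread_sem (m : nat) (t : tape m) : sread (sem t) = tape_read t.
Proof. exact: nth0. Qed.

Lemma sact_sem (m : nat) ad (t : tape m) :
  sact ad (sem t) = sem (tape_move ad.2 (tape_write ad.1 t)).
Proof.
case: ad t => a [] [l r]; rewrite /sact /sem /=; congr pair; apply: funext => i;
  case: i => [|[|i]] /=; by rewrite ?nth_behead ?nth0.
Qed.

Lemma sact_idle (m : nat) (t : stape m) : sact (sread t, MoveNone) t = t.
Proof. by case: t => l r; congr pair; apply: funext; case. Qed.

Lemma sem_rcons_blank_r (m : nat) l r :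
  sem (l, rcons r None) = sem (l, r) :> stape m.
Proof.
by congr pair; apply: funext => i /=; rewrite nth_rcons; case: ltngtP => // h;
  rewrite nth_default // ?h // ltnW.
Qed.

Lemma sem_blank_l (m : nat) r : sem ([:: None], r) = sem ([::], r) :> stape m.
Proof. by congr pair; apply: funext => -[|[]]. Qed.

Arguments sem : simpl never.
Arguments sread : simpl never.
Arguments sact : simpl never.

(** * A polynomial-time decider simulating the selector *)

Section Decider.
Variable M : TM 2.

Let sym := symbol (tm_aux M).
Let idx := 'I_(2 + tm_work M).+1.

(* On input [pairing x (rcons w d)], the decider copies x to a second tape
   ([Read], [Pair]), runs to the end of its input ([Scan]), reads d ([Back]) and
   then moves left over x and w simultaneously, writing them from right to left
   on the input tapes of M in the order given by d ([Copy]); it simulates M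
   ([Sim]) and compares the output with x ([Compare]).  The second bit of [Copy]
   tells whether w has been all 0 so far.  It need not check that |w| = |x|:
   only the last |x| bits before d are ever used. *)
Inductive phase :=
  Read | Pair of bool | Scan | Back | Copy of bool & bool
| Sim of 'I_(tm_nstates M) | Compare.

Definition phase_code (q : phase) :
    option bool + (bool + (bool * bool + option 'I_(tm_nstates M))) :=
  match q with
  | Read => inl None
  | Pair b => inl (Some b)
  | Scan => inr (inl false)
  | Back => inr (inl true)
  | Copy d z => inr (inr (inl (d, z)))
  | Sim q => inr (inr (inr (Some q)))
  | Compare => inr (inr (inr None))
  end.

Definition phase_decode c : phase :=
  match c with
  | inl None => Read
  | inl (Some b) => Pair b
  | inr (inl false) => Scan
  | inr (inl true) => Back
  | inr (inr (inl (d, z))) => Copy d z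
  | inr (inr (inr (Some q))) => Sim q
  | inr (inr (inr None)) => Compare
  end.

Lemma phase_codeK : cancel phase_code phase_decode.
Proof. by case. Qed.

HB.instance Definition _ := Finite.copy phase (can_type phase_codeK).

Definition on_inputs (T : Type) (t0 t1 : T) (u : idx -> T) (i : idx) : T :=
  match val i with 0 => t0 | 1 => t1 | _ => u i end.

(** The symbols [sI], [sA], [s] are read from the input, the copy of x and the tapes of M. In
    [Copy], the test [d && z] rejects the advice reserved for an empty length. *)
Definition decider_delta (q : phase) (sI sA : sym) (s : idx -> sym) :
    (phase + bool) * (sym * direction) * (sym * direction) *
    (idx -> sym * direction) :=
  let idle i := (s i, MoveNone) in
  let reject := (inr false, (sI, MoveNone), (sA, MoveNone), idle) in
  match q with
  | Read =>
    if sI is Some (inl b) then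
      (inl (Pair b), (sI, MoveRight), (sA, MoveNone), idle)
    else reject
  | Pair b =>
    if sI is Some (inl b') then
      if b == b' then (inl Read, (sI, MoveRight), (sI, MoveRight), idle)
      else if b' then (inl Scan, (sI, MoveRight), (sA, MoveNone), idle)
      else reject
    else reject
  | Scan =>
    if sI is Some _ then (inl Scan, (sI, MoveRight), (sA, MoveNone), idle)
    else (inl Back, (sI, MoveLeft), (sA, MoveLeft), idle)
  | Back =>
    (inl (Copy (sI == bit _ true) true), (sI, MoveLeft), (sA, MoveNone), idle)
  | Copy d z =>
    if sA is Some (inl b) then
      let c := sI == bit _ true in
      (inl (Copy d (z && ~~ c)), (sI, MoveLeft), (sA, MoveLeft),
       on_inputs (bit _ (if d then c else b), MoveLeft)
                 (bit _ (if d then b else c), MoveLeft) idle)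
    else if d && z then reject
    else (inl (Sim (tm_start M)), (sI, MoveNone), (sA, MoveRight),
          fun i => on_inputs (s i, MoveRight) (s i, MoveRight) idle i)
  | Sim q =>
    let: (q', act) := tm_delta q [ffun i => s i] in
    (match q' with
     | inl q'' => inl (Sim q'')
     | inr true => inl Compare
     | inr false => inr false
     end, (sI, MoveNone), (sA, MoveNone), fun i => act i)
  | Compare =>
    match sA, s ord_max with
    | Some (inl b), Some (inl c) =>
      if b == c then
        (inl Compare, (sI, MoveNone), (sA, MoveRight),
         fun i => (s i, if i == ord_max then MoveRight else MoveNone))
      else reject
    | None, Some (inl _) => reject
    | None, _ => (inr true, (sI, MoveNone), (sA, MoveNone), idle)
    | _, _ => reject
    end
  end.

(* Abstract configurations: the input tape, the copy of x, the tapes of M. *)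
Record dconfig := DConfig {
  dstate : phase + bool;
  dinput : stape (tm_aux M);
  dcopy : stape (tm_aux M);
  dtapes : idx -> stape (tm_aux M)
}.

Definition dstep (c : dconfig) : dconfig :=
  match dstate c with
  | inr _ => c
  | inl q =>
    let: (q', aI, aA, act) := decider_delta q (sread (dinput c))
      (sread (dcopy c)) (fun i => sread (dtapes c i)) in
    DConfig q' (sact aI (dinput c)) (sact aA (dcopy c))
      (fun i => sact (act i) (dtapes c i))
  end.

Definition halts (c : dconfig) (k : nat) (v : bool) :=
  dstate (iter k dstep c) = inr v.

Lemma halts_step c k v : halts (dstep c) k v -> halts c k.+1 v.
Proof. by rewrite /halts iterSr. Qed.

Lemma halts_leq c k k' v : k <= k' -> halts c k v -> halts c k' v.
Proof.
move=> /subnK<-; rewrite /halts iterD.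
elim: (k' - k) => //= n IHn /IHn h.
by rewrite /dstep h.
Qed.

Lemma halts_now c k v : dstate c = inr v -> halts c k v.
Proof. exact: (@halts_leq c 0). Qed.

Lemma halts_compare tI l x tM l' r :
  tM ord_max = sem (l', r) ->
  halts (DConfig (inl Compare) tI (sem (l, map (bit _) x)) tM) (size x).+1
    (leading_bits r == x).
Proof.
elim: x l tM l' r => [|b x IHx] l tM l' r e; apply: halts_step.
  apply: halts_now; rewrite /dstep /= !sread_sem e sread_sem /tape_read /=.
  by case: r {e} => [|[[c|?]|] r].
rewrite /dstep /= !sread_sem e sread_sem /tape_read /=.
case: r e => [|[[c|?]|] r] e /=; try exact: halts_now.
case: eqVneq => [<-|bc]; last first.
  by apply: halts_now; rewrite /= eqseq_cons [c == b]eq_sym (negbTE bc).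
rewrite sact_idle sact_sem eqseq_cons eqxx /=; apply: IHx.
by rewrite eqxx e sact_sem sread_sem.
Qed.

(** Only an upper bound [n] on the time of M is known: once M halts its iterates are constant, and
    [halts_leq] absorbs the spare steps. *)
Lemma halts_sim n (c : config M) q b tI tA k v :
    cfg_state c = inl q -> cfg_state (iter n (@tm_step 2 M) c) = inr b ->
    (b -> halts (DConfig (inl Compare) tI tA
      (fun i => sem (cfg_tapes (iter n (@tm_step 2 M) c) i))) k v) ->
  halts (DConfig (inl (Sim q)) tI tA (fun i => sem (cfg_tapes c i))) (n + k)
    (b && v).
Proof.
elim: n c q => [|n IHn] c q; first by move=> /= ->.
rewrite iterSr [n.+1 + k]addSn => cq nb hb; apply: halts_step; move: nb hb.
pose s := [ffun i => tape_read (cfg_tapes c i)].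
rewrite /dstep /=.
have -> : [ffun i => sread (sem (cfg_tapes c i))] = s.
  by apply/ffunP => i; rewrite !ffunE sread_sem.
set c' := tm_step c.
have st' : cfg_state c' = (tm_delta q s).1.
  by rewrite /c' /tm_step cq -/s; case: tm_delta.
have tp' : (fun i => sem (cfg_tapes c' i)) =
    (fun i => sact ((tm_delta q s).2 i) (sem (cfg_tapes c i))).
  apply: funext => i; rewrite /c' /tm_step cq -/s; case: tm_delta => q' act /=.
  by rewrite ffunE sact_sem.
case: (tm_delta q s) st' tp' => [[q'|b'] act] /= st' tp' nb hb; rewrite ?sact_idle -tp'.
  exact: IHn.
have e : iter n (@tm_step 2 M) c' = c' by apply: iter_tm_step_halted st'.
move: nb hb; rewrite e st' => -[<-]; case: b' st' => st' /= hb.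
  by apply: halts_leq (hb isT); rewrite leq_addl.
exact: halts_now.
Qed.

Let blank : stape (tm_aux M) := sem ([::], [::]).

Let input_tapes (x y : word) : idx -> stape (tm_aux M) :=
  on_inputs (sem (tape_of_word _ x)) (sem (tape_of_word _ y)) (fun _ => blank).

(* The tapes of M while [Copy] writes on them from right to left: the head is on
   the blank just left of what has been written. *)
Let shifted_input_tapes (x y : word) : idx -> stape (tm_aux M) :=
  on_inputs (sem ([::], None :: map (bit _) x))
    (sem ([::], None :: map (bit _) y)) (fun _ => blank).

(** Cells left of a head are listed nearest first: [y] and [u] remain to be copied, [xr] and [wr]
    are already written. The step beyond [size y] meets the blank before x. *)
Lemma halts_copy (d z : bool) (y u xr wr : word) rI k v :
    size y <= size u ->
  let x := catrev y xr in
  let w := catrev (take (size y) u) wr in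
  let ok := ~~ (d && z && all negb (take (size y) u)) in
  (ok -> forall tI, halts (DConfig (inl (Sim (tm_start M))) tI
     (sem ([::], map (bit _) x))
     (if d then input_tapes w x else input_tapes x w)) k v) ->
  halts (DConfig (inl (Copy d z)) (sem (tape_move MoveLeft (map (bit _) u, rI)))
    (sem (tape_move MoveLeft (map (bit _) y, map (bit _) xr)))
    (if d then shifted_input_tapes wr xr else shifted_input_tapes xr wr))
    ((size y).+1 + k) (ok && v).
Proof.
elim: y u z xr wr rI => [|b y IHy] u z xr wr rI yu x w ok hk; rewrite addSn;
    apply: halts_step.
  rewrite /dstep /= !sread_sem /tape_read /=.
  move: hk; rewrite /ok /x /w take0 /= andbT.
  set tM := (if d then shifted_input_tapes wr xr else _).
  case: (d && z) => [_|hk]; first exact: halts_now.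
  rewrite add0n !sact_sem /tape_read /= sem_blank_l.
  set tM' := (X in DConfig _ _ _ X).
  have -> : tM' = if d then input_tapes wr xr else input_tapes xr wr.
    apply: funext => -[[|[|i]] lti]; rewrite /tM' /tM; case: (d);
      rewrite /shifted_input_tapes /input_tapes /on_inputs /= ?sact_idle //;
      by rewrite sread_sem sact_sem /tape_read /= sem_blank_l.
  exact: hk.
case: u yu @x @w @ok hk => //= c u yu hk.
rewrite /dstep /= !sread_sem /tape_read /= !sact_sem /=.
have -> : (bit (tm_aux M) c == bit (tm_aux M) true) = c by case: (c).
set tM := (X in DConfig _ _ _ X).
have -> : tM = if d then shifted_input_tapes (c :: wr) (b :: xr)
               else shifted_input_tapes (b :: xr) (c :: wr).
  apply: funext => -[[|[|i]] lti]; rewrite /tM; case: (d);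
    rewrite /shifted_input_tapes /on_inputs /= ?sact_idle //;
    by rewrite sact_sem /=.
rewrite andbA -(andbA d); apply: (IHy u _ (b :: xr) (c :: wr)) => // ok tI.
by apply: hk; move: ok; rewrite -!andbA.
Qed.

(** One step per letter of [s], one to turn back at the blank, one for [Back]. *)
Lemma halts_scan (u s y : word) (tM : idx -> stape (tm_aux M)) k v :
  let z := catrev u s in
  (forall rI, halts (DConfig (inl (Copy (last false z) true))
     (sem (tape_move MoveLeft (map (bit _) (behead (rev z)), rI)))
     (sem (tape_move MoveLeft (map (bit _) y, [::]))) tM) k v) ->
  halts (DConfig (inl Scan) (sem (map (bit _) u, map (bit _) s))
    (sem (map (bit _) y, [::])) tM) ((size s).+2 + k) v.
Proof.
have idleE : (fun i => sact (sread (tM i), MoveNone) (tM i)) = tM.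
  by apply: funext => i; rewrite sact_idle.
elim: s u => [|a s IHs] u /= hk; rewrite addSn; apply: halts_step; last first.
  rewrite /dstep /= sread_sem /tape_read /= sact_idle idleE sact_sem /=.
  by apply: (IHs (a :: u)).
rewrite addSn; apply: halts_step.
rewrite /dstep /= !sread_sem /tape_read /= !sact_sem /=.
have -> : (fun i => sact (sread (sact (sread (tM i), MoveNone) (tM i)), MoveNone)
   (sact (sread (tM i), MoveNone) (tM i))) = tM.
  by apply: funext => i; rewrite !sact_idle.
rewrite sread_sem /tape_read /=.
have -> : sem (behead [seq bit (tm_aux M) i | i <- y],
    [:: head None [seq bit (tm_aux M) i | i <- y]; None]) =
    sem (tape_move MoveLeft (map (bit _) y, [::])).
  exact: (sem_rcons_blank_r _ [:: _]).
move: hk; rewrite /= -/(rev u) revK.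
(* On empty input [Back] reads a blank, taken as false like the default of [last]. *)
case: u => [|c u] hk; first exact: (hk [:: None; None]).
have /= := hk [:: bit _ c; None].
by rewrite rev_cons last_rcons; case: (c).
Qed.

(** The parsing done by [Read] and [Pair]; it drops the second component because the advice is read
    from the right end. *)
Fixpoint undouble (s : word) : option word :=
  if s is b :: b' :: s' then
    if b == b' then omap (cons b) (undouble s')
    else if b' then Some [::] else None
  else None.

(** Ensures that |x| letters precede the last one, and that two words of length |x| are together
    shorter than the pair. *)
Lemma size_undouble s x : undouble s = Some x -> (size x).*2.+2 <= size s.
Proof.
have [n] := ubnP (size s); elim: n s x => // n IHn [|b [|b' s]] x //= sn.
case: eqP => _; last by case: b' => // -[<-].
case e: (undouble s) => [y|] //= [<-] /=.
by rewrite !ltnS; apply: IHn => //; exact: ltnW.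
Qed.

Lemma undouble_pairing x y : undouble (pairing x y) = Some x.
Proof. by elim: x => //= b x; rewrite /pairing /= eqxx => ->. Qed.

(** Reading, like scanning, consumes one letter per step, so the bound of [halts_scan] persists;
    unparsable input is rejected. *)
Lemma halts_read (s u y : word) (tM : idx -> stape (tm_aux M)) k v :
  let z := catrev u s in
  (if undouble s is Some x then
     forall rI, halts (DConfig (inl (Copy (last false z) true))
       (sem (tape_move MoveLeft (map (bit _) (behead (rev z)), rI)))
       (sem (tape_move MoveLeft (map (bit _) (catrev x y), [::]))) tM) k v
   else v = false) ->
  halts (DConfig (inl Read) (sem (map (bit _) u, map (bit _) s))
    (sem (map (bit _) y, [::])) tM) ((size s).+2 + k) v.
Proof.
have idleE : (fun i => sact (sread (tM i), MoveNone) (tM i)) = tM.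
  by apply: funext => i; rewrite sact_idle.
have [n] := ubnP (size s); elim: n s u y => // n IHn [|b [|b' s]] u y sn /= hv.
- by apply: halts_step; rewrite hv; exact: halts_now.
- by do 2!apply: halts_step; rewrite hv; exact: halts_now.
rewrite !addSn; apply: halts_step; apply: halts_step.
rewrite {2}/dstep /= sread_sem /tape_read /= sact_idle idleE sact_sem.
rewrite /dstep /= sread_sem /tape_read /=.
move: hv; case: eqP => [<-|_].
  move=> hv; rewrite idleE !sact_sem /= -!addSn; apply: (IHn s (b :: b :: u) (b :: y)).
    exact: ltnW.
  by case: undouble hv.
case: b' sn => sn hv; last by apply: halts_now; rewrite hv.
rewrite sact_idle idleE sact_sem /= -!addSn.
by apply: (@halts_scan (true :: b :: u)).
Qed.

Section Correctness.
Variables (f : word -> word -> option word) (p : {poly nat}).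
Hypothesis Mf : computes_within M p f.

(** Total, so that it also describes the machine on malformed pairs, where [w] may overlap the
    encoding of x. *)
Definition verdict (z : word) : bool :=
  if undouble z is Some x then
    let d := last false z in
    let w := rev (take (size x) (behead (rev z))) in
    ~~ (d && all negb w) && ((if d then f w x else f x w) == Some x)
  else false.

Lemma halts_sim_init x y a tI :
  halts (DConfig (inl (Sim (tm_start M))) tI (sem ([::], map (bit _) a))
    (input_tapes x y)) (p.[(size x + size y)%N]%R + (size a).+1)
    (f x y == Some a).
Proof.
have -> : input_tapes x y = fun i => sem (cfg_tapes (tm_init M [tuple x; y]) i).
  apply: funext => -[[|[|i]] lti];
    rewrite /input_tapes /on_inputs /= ffunE //=.
  by rewrite nth_nil.
have := Mf x y; case: (f x y) => [z [acc out]|rej].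
  apply: (halts_sim _ acc) => // _.
  by rewrite -out; apply: halts_compare; exact: erefl.
by apply: (@halts_sim _ _ _ false _ _ _ false _ rej).
Qed.

Lemma halts_decider (z : word) :
  halts (DConfig (inl Read) (sem (tape_of_word _ z)) blank (fun _ => blank))
    (p.[size z]%R + (size z).*2.+2) (verdict z).
Proof.
(* Copying, simulation, comparison; by [size_undouble] the 2|x|+2 steps outside the simulation are
   at most |z|. *)
pose t (x : word) := (size x).+1 + (p.[size z]%R + (size x).+1).
pose k := if undouble z is Some x then t x else 0.
apply: (@halts_leq _ ((size z).+2 + k)).
  rewrite /k; case e: undouble => [x|] /=; last by lia.
  by have := size_undouble e; rewrite /t; lia.
apply: (@halts_read z [::] [::]); rewrite /verdict /k.
case e: undouble => [x|] // rI.
have xz : (size (rev x)) <= size (behead (rev z)).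
  by have := size_undouble e; rewrite size_behead !size_rev; lia.
(* An explicit blank under the head is invisible to [sem], so blank tapes are ready for [Copy]. *)
have -> : (fun _ => blank) =
    if last false z then shifted_input_tapes [::] [::]
    else shifted_input_tapes [::] [::].
  apply: funext => i; rewrite if_same /shifted_input_tapes /on_inputs /=.
  by case: i => -[|[|i]] ?; rewrite /blank // -(sem_rcons_blank_r _ [::]).
rewrite all_rev; set w := take _ _.
have := @halts_copy (last false z) true (rev x) (behead (rev z)) [::] [::] rI _ _ xz.
rewrite -/(rev _) revK size_rev andbT -/w; apply => _ tI.
have sw : size (rev w) = size x.
  by rewrite size_rev size_takel // -(size_rev x).
have pz a b : size a = size x -> size b = size x ->
    p.[(size a + size b)%N]%R <= p.[size z]%R.
  move=> -> ->; apply: horner_nat_leq; have := size_undouble e; lia.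
case: ifP => _; apply: halts_leq (halts_sim_init _ _ _ _);
  by rewrite leq_add2r pz.
Qed.

(** Tape 0 is the input, tape 1 the copy of x, the rest are those of M in order; the two forms of
    the tape count are convertible. *)
Let tape_index (k : 'I_2) : 'I_(1 + (3 + tm_work M)).+1 :=
  lshift (2 + tm_work M).+1 k.

Let sim_index (i : idx) : 'I_(1 + (3 + tm_work M)).+1 := rshift 2 i.

Definition decider : TM 1 := @MkTM 1 (3 + tm_work M) (tm_aux M) #|{: phase}|
  (enum_rank Read)
  (fun q s =>
    let: (q', aI, aA, act) := decider_delta (enum_val q) (s (tape_index ord0))
      (s (tape_index ord_max)) (fun i => s (sim_index i)) in
    (match q' with inl q'' => inl (enum_rank q'') | inr b => inr b end,
     [ffun j : 'I_(2 + (2 + tm_work M).+1) => match split j with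
      | inl k => if k == ord0 then aI else aA
      | inr i => act i
      end])).

Definition abstraction (c : config decider) : dconfig :=
  DConfig
    (match cfg_state c with inl q => inl (enum_val q) | inr b => inr b end)
    (sem (cfg_tapes c (tape_index ord0)))
    (sem (cfg_tapes c (tape_index ord_max)))
    (fun i => sem (cfg_tapes c (sim_index i))).

Lemma abstraction_step c : abstraction (tm_step c) = dstep (abstraction c).
Proof.
rewrite /dstep /tm_step /abstraction /=.
case e: (cfg_state c) => [q|b] /=; last by rewrite e.
rewrite !ffunE !sread_sem.
have -> : (fun i => [ffun i => tape_read (cfg_tapes c i)] (sim_index i)) =
    (fun i => sread (sem (cfg_tapes c (sim_index i)))).
  by apply: funext => i; rewrite ffunE sread_sem.
case: decider_delta => [[[q' aI] aA] act] /=; rewrite !ffunE.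
rewrite (unsplitK (inl ord0)) (unsplitK (inl ord_max)) /= !sact_sem.
congr DConfig; first by case: q' => // q'; rewrite enum_rankK.
by apply: funext => i; rewrite !ffunE (unsplitK (inr i)) sact_sem.
Qed.

Lemma class_P_verdict : class_P [set z | verdict z].
Proof.
exists decider, (p + 'X + 'X + 2%:P)%R => z.
suff run : cfg_state (tm_run decider [tuple z] (p + 'X + 'X + 2%:P).[size z]%R)
    = inr (verdict z).
  by rewrite /accepts_within /rejects_within run /=; split => [->|/negP/negbTE->].
have abs k : abstraction (tm_run decider [tuple z] k) = iter k dstep
    (DConfig (inl Read) (sem (tape_of_word _ z)) blank (fun _ => blank)).
  elim: k => [|k IHk]; last by rewrite iterS -IHk -abstraction_step.
  rewrite /abstraction /= enum_rankK !ffunE /=; congr DConfig.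
  by apply: funext => i; rewrite ffunE.
have -> : (p + 'X + 'X + 2%:P).[size z]%R = p.[size z]%R + (size z).*2.+2.
  transitivity (p.[size z]%R + size z + size z + 2); last by lia.
  by rewrite !hornerD !hornerX hornerC.
have := halts_decider z; rewrite /halts -abs /=.
by case: cfg_state => // b [->].
Qed.
End Correctness.
End Decider.

(** * Advice from an associative selector *)

Lemma associative_selector_advice (B : set word) f (n : nat) :
  FP_selector B f -> associative_at_each_length f ->
  exists (w : n.-tuple bool) (d : bool), forall x : n.-tuple bool,
    B x <-> ~~ (d && all negb w) && ((if d then f w x else f x w) == Some (x : word)).
Proof.
move=> [_ sel] assoc.
pose P := [pred x : n.-tuple bool | `[< B x >]].
pose g (x y : n.-tuple bool) := if f x y == Some (x : word) then x else y.
have fg x y : P x -> P y -> f x y = Some (g x y : word).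
  move=> /asboolP Bx /asboolP By; have [sub tot] := sel x y.
  have [|[z fz] _] := tot _; first by exists x; split => //; left.
  by rewrite /g; case: eqP => // nx; case: (sub z fz) => e; rewrite fz e // -e in nx *.
have gsel x y : P x -> P y -> g x y = x \/ g x y = y.
  by move=> _ _; rewrite /g; case: ifP; [left|right].
have gP x y : P x -> P y -> P (g x y).
  by move=> Px Py; case: (gsel x y Px Py) => ->.
have gassoc x y z : P x -> P y -> P z -> g x (g y z) = g (g x y) z.
  move=> Px Py Pz; have := assoc n x y z.
  move=> /(congr1 (fun A => A (g x (g y z) : word))); rewrite /set_f_r /set_f_l.
  have l : (\bigcup_(a in set_f f y z) set_f f x a) (g x (g y z)).
    by exists (g y z : word); rewrite /set_f /= fg // gP.
  move=> e; move: l; rewrite e => -[a]; rewrite /set_f /= fg // => -[<-].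
  by rewrite fg // ?gP // => -[] /val_inj.
have [[x0 Px0]|none] := pselect (exists x, P x); last first.
  (* B has no word of length n, and the reserved pair rejects all of them. *)
  exists [tuple of nseq n false], true => x; rewrite all_nseq orbT /=.
  by split=> // Bx; case: none; exists x; apply/asboolP.
have [w [d [Pw nz base]]] :=
  quasitrivial_one_sided_base gsel gassoc [tuple of nseq n false] Px0.
exists w, d => x; split=> [Bx|/andP[_ /eqP fx]].
  have Px : P x by apply/asboolP.
  apply/andP; split; last first.
    by have := base x Px; case: (d) => gx; rewrite fg // gx.
  apply: contra nz => /andP[->].
  rewrite (@eq_all _ _ (pred1 false)) => [|[]//] /all_pred1P.
  by move=> w0; apply/eqP/val_inj; rewrite /= {1}w0 size_tuple.
(* As [w] is in B, the value of the selector on [w] and [x] is in B, and that value is [x]. *)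
have /asboolP Bw := Pw.
case: d fx {nz base} => fx.
  have [_ tot] := sel w x; case: tot => [|_]; first by exists w; split=> //; left.
  exact.
have [_ tot] := sel x w; case: tot => [|_]; first by exists w; split=> //; right.
exact.
Qed.

Lemma Al_FP_sel_advice : Al_FP_sel `<=` P_slash_n_plus_1.
Proof.
move=> B [f [sel assoc]].
(* Words replace tuples so that one type serves every n, as [choice] requires. *)
have /choice[h hP] n : exists wd : word * bool, size wd.1 = n /\
    forall x : n.-tuple bool, B x <-> ~~ (wd.2 && all negb wd.1) &&
      ((if wd.2 then f wd.1 x else f x wd.1) == Some (x : word)).
  have [w [d wdP]] := associative_selector_advice n sel assoc.
  by exists (tval w, d); rewrite size_tuple.
have [[M [p Mf]] _] := sel.
exists [set z | verdict f z], (fun n => rcons (h n).1 (h n).2).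
split=> [|x]; first exact: class_P_verdict Mf.
have [sw wdP] := hP (size x); move: sw wdP; case: (h _) => w d /= sw wdP.
rewrite size_rcons sw addn1; split=> //.
rewrite /verdict undouble_pairing last_pairing -?size_eq0 ?size_rcons //.
rewrite last_rcons.
have -> : rev (take (size x) (behead (rev (pairing x (rcons w d))))) = w.
  rewrite /pairing !rev_cat rev_rcons /= -catA -sw.
  by rewrite -(size_rev w) take_size_cat // revK.
exact: (wdP (in_tuple x)).
Qed.

Theorem theorem5p3 : (Al_FP_sel `<` P_slash_n_plus_1)%classic.
Proof.
split=> [|sub]; first exact: Al_FP_sel_advice.
have [c noselector] := length_class_without_selector.
by have [f [/noselector]] := sub _ (length_class_advice c).
Qed.
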